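(* Let $\mathcal G$ be a $\Gamma$-periodic graph in $\mathbb R^d$ with fixed (possibly equal) vertices $v_1,v_2\in\mathcal V\cap\Omega$, and let $Q$ be a real periodic potential given by a vector $(Q_v)_{v\in\mathcal V_*}\in\mathbb R^\nu$, $\nu=\#\mathcal V_*$. Let $t=(t_1,\ldots,t_d)\in\mathbb Z^d$ and $j\in\{1,\ldots,\nu\}$. Then, for each choice of sign $\pm$, the band edge $\lambda_j^\pm(t)$ of the Schrödinger operator $H_{\mathcal G_t}=\Delta_{\mathcal G_t}+Q$ on the perturbed graph $\mathcal G_t$ coincides with the corresponding band edge $\widetilde\lambda_j^\pm$ of $H_{\widetilde{\mathcal G}}=\Delta_{\widetilde{\mathcal G}}+Q$ on its limit graph $\widetilde{\mathcal G}$, i.e. $\lambda_j^\pm(t)=\widetilde\lambda_j^\pm$, if and only if $$t_1k_1^o+\ldots+t_dk_d^o\equiv k_{d+1}^o \pmod{2\pi}$$ for some $k_o=(k_1^o,\ldots,k_d^o,k_{d+1}^o)\in K_j^\pm$, where $$K_j^\pm=\{k\in\mathbb T^{d+1}:\widetilde\lambda_j(k)=\widetilde\lambda_j^\pm\}.$$ In particular, if $0\in K_j^\pm$, then $\lambda_j^\pm(t)=\widetilde\lambda_j^\pm$.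
   Context: **Periodic graphs.** Let $\Gamma$ be a lattice of rank $d$ in $\mathbb R^d$ with basis $\mathfrak a_1,\ldots,\mathfrak a_d$ and fundamental cell $\Omega=\{\sum_{s=1}^d x_s\mathfrak a_s: x_s\in[0,1)\}$. A $\Gamma$-periodic graph $\mathcal G=(\mathcal V,\mathcal E)$ is a connected infinite locally finite graph embedded in $\mathbb R^d$ (loops and multiple edges allowed) that is invariant under translation by every vector of $\Gamma$ and whose quotient $\mathcal G_*=\mathcal G/\Gamma=(\mathcal V_*,\mathcal E_* )$ (the fundamental graph) is finite. Vertices of $\mathcal G_*$ are identified with the vertices in $\mathcal V\cap\Omega$. Each unoriented edge (also each loop) gives two oriented edges $\mathbf e$ and $\overline{\mathbf e}$ (mutually inverse); $\mathcal A$ and $\mathcal A_*=\mathcal A/\Gamma$ are the sets of oriented edges of $\mathcal G$ and $\mathcal G_*$. **Edge indices.** Every $v\in\mathcal V$ is uniquely $v=v_0+[v]$ with $v_0\in\mathcal V\cap\Omega$, $[v]\in\Gamma$. The index of an oriented edge $\mathbf e=(u,v)\in\mathcal A$ is the vector $\tau(\mathbf e)\in\mathbb Z^d$ of coordinates of $[v]-[u]$ in the basis $\mathfrak a_1,\ldots,\mathfrak a_d$. It is $\Gamma$-invariant, so it defines $\tau(\mathbf e)$ for $\mathbf e\in\mathcal A_*$; moreover $\tau(\overline{\mathbf e})=-\tau(\mathbf e)$. **Schrödinger operators and band edges.** For a $\Gamma$-periodic potential $Q:\mathcal V\to\mathbb R$ (determined by $(Q_v)_{v\in\mathcal V_*}$),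 $H=\Delta+Q$ acts on $\ell^2(\mathcal V)$ by $(\Delta f)_v=\sum_{(v,u)\in\mathcal A}(f_v-f_u)$, $(Qf)_v=Q_vf_v$. With $\mathbb T^d=(-\pi,\pi]^d=\mathbb R^d/2\pi\mathbb Z^d$, the fiber operators on $\ell^2(\mathcal V_* )=\mathbb C^\nu$, $\nu=\#\mathcal V_*$, are $H(k)=\Delta(k)+Q$, $(\Delta(k)f)_v=\sum_{\mathbf e=(v,u)\in\mathcal A_*}(f_v-e^{i\langle\tau(\mathbf e),k\rangle}f_u)$. The eigenvalues $\lambda_1(k)\le\ldots\le\lambda_\nu(k)$ of $H(k)$, counted with multiplicity, are the band functions; the band edges are $\lambda_j^-=\min_{k\in\mathbb T^d}\lambda_j(k)$, $\lambda_j^+=\max_{k\in\mathbb T^d}\lambda_j(k)$, and $\sigma(H)=\bigcup_{j=1}^\nu[\lambda_j^-,\lambda_j^+]$. The same definitions apply to periodic graphs in any dimension. **Perturbed graph.** For $t=(t_1,\ldots,t_d)\in\mathbb Z^d$, $\mathcal G_t$ is the $\Gamma$-periodic graph obtained from $\mathcal G$ (same vertex set) by adding the edges $\mathbf e_o+\mathfrak a$, $\mathfrak a\in\Gamma$, where $\mathbf e_o=(v_1,v_2+t_1\mathfrak a_1+\ldots+t_d\mathfrak a_d)$. Its fundamental graph is $(\mathcal V_*,\mathcal E_*\cup\{\mathbf e_o\})$, the added edge $\mathbf e_o=(v_1,v_2)$ having index $t$. Its band edges are denoted $\lambda_j^\pm(t)$. **Limit graph.** Complete $\mathfrak a_1,\ldots,\mathfrak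 a_d$ (with $\mathbb R^d$ viewed as $\mathbb R^d\times\{0\}\subset\mathbb R^{d+1}$) by a vector $\mathfrak a_{d+1}$ to a basis of $\mathbb R^{d+1}$, and let $\widetilde\Gamma$ be the lattice with basis $\mathfrak a_1,\ldots,\mathfrak a_{d+1}$. The limit graph $\widetilde{\mathcal G}$ is the $\widetilde\Gamma$-periodic graph consisting of the copies $\mathcal G+n\mathfrak a_{d+1}$, $n\in\mathbb Z$, together with the edges $\mathbf e_o+\mathfrak a$, $\mathfrak a\in\widetilde\Gamma$, where $\mathbf e_o=(v_1,v_2+\mathfrak a_{d+1})$. Its fundamental graph is also $(\mathcal V_*,\mathcal E_*\cup\{\mathbf e_o\})$; with respect to $\widetilde\Gamma$, the edges of $\mathcal A_*$ have indices $(\tau(\mathbf e),0)\in\mathbb Z^{d+1}$ and $\mathbf e_o$ has index $(0,\ldots,0,1)$. The potential on $\widetilde{\mathcal G}$ is the $\widetilde\Gamma$-periodic potential given by the same vector $(Q_v)_{v\in\mathcal V_*}$. The band functions of $H_{\widetilde{\mathcal G}}$ on $\mathbb T^{d+1}$ are denoted $\widetilde\lambda_j(\cdot)$, and its band edges $\widetilde\lambda_j^\pm$. *)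

(* Defs.v *)
From HB Require Import structures.
From mathcomp Require Import all_boot all_order all_algebra finmap.
From mathcomp Require Import all_classical all_reals all_analysis.
From mathcomp Require Import complex.

Set Implicit Arguments.
Unset Strict Implicit.
Unset Printing Implicit Defensive.

Import Order.TTheory GRing.Theory Num.Theory.

Local Open Scope classical_set_scope.
Local Open Scope ring_scope.

(** * Periodic graphs *)

(* Raw data of a graph in R^d together with a lattice Gamma. Vertices are points
   of R^d. Edges are abstract, so that loops and multiple edges are possible:
   [edge] is the set of oriented edges and [erev] exchanges the two orientations
   of an edge. A lattice vector is represented by its integer coordinates in the
   basis, and [eshift n] is the translation of oriented edges by that vector. *)
Record lattice_graph (R : realType) (d : nat) := LatticeGraph {
  basis : 'M[R]_d;                        (* row s is the basis vector a_s *)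
  vert  : set 'rV[R]_d;
  edge  : choiceType;
  esrc   : edge -> 'rV[R]_d;
  etgt   : edge -> 'rV[R]_d;
  erev   : edge -> edge;
  eshift : 'rV[int]_d -> edge -> edge
}.

Section PeriodicGraphs.
Context {R : realType} {d : nat}.
Implicit Types (G : lattice_graph R d) (n : 'rV[int]_d) (v : 'rV[R]_d).

(* the lattice vector n_1 a_1 + ... + n_d a_d *)
Definition latvec (A : 'M[R]_d) n : 'rV[R]_d := map_mx intr n *m A.

(* the fundamental cell Omega *)
Definition cell (A : 'M[R]_d) : set 'rV[R]_d :=
  [set x *m A | x in [set x : 'rV[R]_d | forall s, 0 <= x 0 s < 1]].

Fixpoint walk G (u : 'rV[R]_d) (p : seq (edge G)) (w : 'rV[R]_d) : Prop :=
  if p is e :: p' then esrc e = u /\ walk (etgt e) p' w else u = w.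

(* V_*, identified with the vertices in the fundamental cell *)
Definition fund_vert G : set 'rV[R]_d := vert G `&` cell (basis G).

Definition edge_orbit G (e : edge G) : set (edge G) :=
  [set eshift n e | n in [set: 'rV[int]_d]].

Record is_periodic_graph G : Prop := IsPeriodicGraph {
  basis_unit : basis G \in unitmx;
  src_vert : forall e : edge G, vert G (esrc e);
  tgt_vert : forall e : edge G, vert G (etgt e);
  revK : forall e : edge G, erev (erev e) = e;
  rev_neq : forall e : edge G, erev e <> e;
  src_rev : forall e : edge G, esrc (erev e) = etgt e;
  vert_shift : forall v n, vert G v -> vert G (v + latvec (basis G) n);
  shift0 : forall e : edge G, eshift 0 e = e;
  shiftD : forall m n (e : edge G), eshift (m + n) e = eshift m (eshift n e);
  src_shift : forall n (e : edge G), esrc (eshift n e) = esrc e + latvec (basis G) n;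
  tgt_shift : forall n (e : edge G), etgt (eshift n e) = etgt e + latvec (basis G) n;
  rev_shift : forall n (e : edge G), erev (eshift n e) = eshift n (erev e);
  vert_infinite : infinite_set (vert G);
  vert_connected : forall u w, vert G u -> vert G w ->
    exists p : seq (edge G), walk u p w;
  locally_finite : forall v, vert G v -> finite_set [set e : edge G | esrc e = v];
  fund_vert_finite : finite_set (fund_vert G);
  fund_edge_finite : finite_set (range (@edge_orbit G))
}.

(* The decomposition v = v_0 + [v] with v_0 in the cell and [v] in the lattice;
   [cell_index] gives the integer coordinates of [v]. *)
Definition cell_index G v : 'rV[int]_d :=
  \row_s Num.floor ((v *m invmx (basis G)) 0 s).

Definition cell_part G v : 'rV[R]_d := v - latvec (basis G) (cell_index G v).

Definition edge_index G (e : edge G) : 'rV[int]_d :=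
  cell_index G (etgt e) - cell_index G (esrc e).

Definition periodic_potential G (Q : 'rV[R]_d -> R) : Prop :=
  forall v n, vert G v -> Q (v + latvec (basis G) n) = Q v.

(** * Fiber operators and band edges *)

Definition torus : set 'rV[R]_d := [set k | forall s, - pi < k 0 s <= pi].

Definition expi (x : R) : R[i] := Complex (cos x) (sin x).

Definition phase n (k : 'rV[R]_d) : R := \sum_s (n 0 s)%:~R * k 0 s.

(* H(k) acting on functions on V_*; values of f and Q outside V_* are irrelevant
   when v is in V_*. The oriented edges of G_* starting at v in V_* are represented
   by the oriented edges of G starting at the point v (see fund_edge_repr). *)
Definition fiber_op G (Q : 'rV[R]_d -> R) (k : 'rV[R]_d)
    (f : 'rV[R]_d -> R[i]) (v : 'rV[R]_d) : R[i] :=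
  \sum_(e \in [set e : edge G | esrc e = v])
     (f v - expi (phase (edge_index e) k) * f (cell_part G (etgt e)))
  + (Q v)%:C%C * f v.

(* nu = # V_* *)
Definition nu G : nat := #|` fset_set (fund_vert G)|%fset.

(* an enumeration (without repetition) of V_* *)
Definition fund_nth G (i : nat) : 'rV[R]_d := nth 0 (fset_set (fund_vert G)) i.

(* the matrix of H(k) in the basis of indicator functions of the points of V_* *)
Definition fiber_mx G Q k : 'M[R[i]]_(nu G) :=
  \matrix_(i, j)
    fiber_op G Q k (fun w => (w == fund_nth G j)%:R) (fund_nth G i).

End PeriodicGraphs.

(* eigenvalues repeated according to multiplicity, in no particular order *)
Definition eigenvalues (C : closedFieldType) m (A : 'M[C]_m) : seq C :=
  sval (closed_field_poly_normal (char_poly A)).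

Section Bands.
Context {R : realType} {d : nat}.
Implicit Types (G : lattice_graph R d) (Q : 'rV[R]_d -> R) (k : 'rV[R]_d).

(* The j-th band function, with j counted from 1. H(k) is Hermitian, so that its
   eigenvalues are real and nothing is lost by taking real parts. *)
Definition band_fun G Q (j : nat) k : R :=
  nth 0 (sort <=%R [seq complex.Re z | z <- eigenvalues (fiber_mx G Q k)]) j.-1.

End Bands.

(* minimum and maximum of a set of reals (0 if there is none) *)
Definition set_min {R : realType} (S : set R) : R := xget 0 (S `&` lbound S).
Definition set_max {R : realType} (S : set R) : R := xget 0 (S `&` ubound S).

Variant band_side := Lower | Upper.

Section BandEdges.
Context {R : realType} {d : nat}.
Implicit Types (G : lattice_graph R d) (Q : 'rV[R]_d -> R).

(* lambda_j^- for [Lower] and lambda_j^+ for [Upper] *)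
Definition band_edge (side : band_side) G Q (j : nat) : R :=
  match side with
  | Lower => set_min (band_fun G Q j @` torus)
  | Upper => set_max (band_fun G Q j @` torus)
  end.

(* K_j^- and K_j^+ *)
Definition band_level (side : band_side) G Q (j : nat) : set 'rV[R]_d :=
  torus `&` [set k | band_fun G Q j k = band_edge side G Q j].

End BandEdges.

Definition eq_mod_2pi {R : realType} (x y : R) : Prop :=
  exists m : int, x - y = m%:~R * (2 * pi).

(** * Perturbed graph and limit graph *)

Section Perturbations.
Context {R : realType} {d : nat}.
Variables (G : lattice_graph R d) (v1 v2 : 'rV[R]_d).

(* In both graphs below the added oriented edges are the pairs (c, n): (false, n) is
   the translate of e_o by the lattice vector n, and (true, n) is its reverse. *)

Section Perturbed.
Variable t : 'rV[int]_d.
Let A := basis G.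

Definition pert_edge : choiceType := (edge G + bool * 'rV[int]_d)%type.

Definition pert_start (n : 'rV[int]_d) := v1 + latvec A n.
Definition pert_stop (n : 'rV[int]_d) := v2 + latvec A t + latvec A n.

Definition pert_src (e : pert_edge) : 'rV[R]_d :=
  match e with
  | inl e => esrc e
  | inr (c, n) => if c then pert_stop n else pert_start n
  end.

Definition pert_tgt (e : pert_edge) : 'rV[R]_d :=
  match e with
  | inl e => etgt e
  | inr (c, n) => if c then pert_start n else pert_stop n
  end.

Definition pert_rev (e : pert_edge) : pert_edge :=
  match e with
  | inl e => inl (erev e)
  | inr (c, n) => inr (~~ c, n)
  end.

Definition pert_shift (m : 'rV[int]_d) (e : pert_edge) : pert_edge :=
  match e with
  | inl e => inl (eshift m e)
  | inr (c, n) => inr (c, m + n)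
  end.

(* G_t *)
Definition perturbed_graph : lattice_graph R d :=
  LatticeGraph A (vert G) pert_src pert_tgt pert_rev pert_shift.

End Perturbed.

Section Limit.
Variable b : 'rV[R]_(d + 1).            (* the vector a_{d+1} *)

(* R^d viewed as R^d x {0} *)
Definition embed (v : 'rV[R]_d) : 'rV[R]_(d + 1) := row_mx v 0.

Definition limit_basis : 'M[R]_(d + 1) := col_mx (row_mx (basis G) 0) b.

Definition limit_vert : set 'rV[R]_(d + 1) :=
  [set w | exists v (m : int), vert G v /\ w = embed v + m%:~R *: b].

(* (e, m) is the copy of e in G + m a_{d+1} *)
Definition limit_edge : choiceType :=
  (edge G * int + bool * 'rV[int]_(d + 1))%type.

Definition limit_start (n : 'rV[int]_(d + 1)) := embed v1 + latvec limit_basis n.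
Definition limit_stop (n : 'rV[int]_(d + 1)) :=
  embed v2 + b + latvec limit_basis n.

Definition limit_src (e : limit_edge) : 'rV[R]_(d + 1) :=
  match e with
  | inl (e, m) => embed (esrc e) + m%:~R *: b
  | inr (c, n) => if c then limit_stop n else limit_start n
  end.

Definition limit_tgt (e : limit_edge) : 'rV[R]_(d + 1) :=
  match e with
  | inl (e, m) => embed (etgt e) + m%:~R *: b
  | inr (c, n) => if c then limit_start n else limit_stop n
  end.

Definition limit_rev (e : limit_edge) : limit_edge :=
  match e with
  | inl (e, m) => inl (erev e, m)
  | inr (c, n) => inr (~~ c, n)
  end.

Definition limit_shift (n : 'rV[int]_(d + 1)) (e : limit_edge) : limit_edge :=
  match e with
  | inl (e, m) => inl (eshift (lsubmx n) e, rsubmx n 0 0 + m)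
  | inr (c, n') => inr (c, n + n')
  end.

Definition limit_graph : lattice_graph R (d + 1) :=
  LatticeGraph limit_basis limit_vert limit_src limit_tgt limit_rev limit_shift.

(* The periodic potential on the limit graph given by the same vector (Q_v): the
   points of the fundamental cell of the limit graph are the points (v, 0) with v
   in V_*. *)
Definition limit_potential (Q : 'rV[R]_d -> R) (w : 'rV[R]_(d + 1)) : R :=
  Q (lsubmx (cell_part limit_graph w)).

End Limit.
End Perturbations.

(** * The constructions are well defined *)

Section Lattice.
Context {R : realType} {d : nat}.
Variable A : 'M[R]_d.
Hypothesis Aunit : A \in unitmx.

Lemma latvec0 : latvec A 0 = 0.
Proof. by rewrite /latvec map_mx0 mul0mx. Qed.

Lemma latvecD m n : latvec A (m + n) = latvec A m + latvec A n.
Proof. by rewrite /latvec map_mxD mulmxDl. Qed.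

Lemma latvecN n : latvec A (- n) = - latvec A n.
Proof. by rewrite /latvec map_mxN mulNmx. Qed.

Lemma latvec_coord n s : (latvec A n *m invmx A) 0 s = (n 0 s)%:~R.
Proof. by rewrite /latvec mulmxK // mxE. Qed.

Lemma latvec_inj : injective (latvec A).
Proof.
move=> m n mn; apply/rowP => s; apply: (@intr_inj R).
by rewrite -!latvec_coord mn.
Qed.

Lemma latvec_finite (v w : 'rV[R]_d) :
  finite_set [set n | v + latvec A n = w].
Proof.
have [[n0 n0w]|n0w] := pselect (exists n0, v + latvec A n0 = w).
  apply: (sub_finite_set _ (finite_set1 n0)) => n /= nw.
  by apply: latvec_inj; apply: (addrI v); rewrite nw n0w.
by apply: (sub_finite_set _ (finite_set0 _)) => n /= nw; apply: n0w; exists n.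
Qed.

Lemma cellP (v : 'rV[R]_d) :
  cell A v <-> forall s, 0 <= (v *m invmx A) 0 s < 1.
Proof.
split=> [[x x01 <-] s|v01]; first by rewrite mulmxK //; exact: x01.
by exists (v *m invmx A); [exact: v01|rewrite mulmxKV].
Qed.

Lemma cell_uniq (v : 'rV[R]_d) n : cell A v -> cell A (v + latvec A n) -> n = 0.
Proof.
move=> /cellP v01 /cellP w01; apply/rowP => s; rewrite mxE.
have /andP[v0 v1] := v01 s; have /andP[] := w01 s.
rewrite mulmxDl mxE latvec_coord => w0 w1.
have : (n 0 s)%:~R < 1 :> R by apply: le_lt_trans w1; rewrite lerDr.
have : - 1 < (n 0 s)%:~R :> R.
  rewrite -subr_gt0 opprK addrC; apply: le_lt_trans w0 _.
  by rewrite ltrD2r.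
have -> : - 1 = (- 1)%:~R :> R by [].
rewrite ltr_int ltrz1 => n0 n1; apply/eqP; rewrite eq_le.
by rewrite -ltzD1 add0r n1 /=; move: n0; rewrite -lezD1 addNr.
Qed.

End Lattice.

Section Walks.
Context {R : realType} {d : nat}.
Variable G : lattice_graph R d.
Hypothesis revK : forall e : edge G, erev (erev e) = e.
Hypothesis src_rev : forall e : edge G, esrc (erev e) = etgt e.

Definition linked u w := exists p : seq (edge G), walk u p w.

Lemma linked_refl u : linked u u. Proof. by exists [::]. Qed.

Lemma linked_trans u v w : linked u v -> linked v w -> linked u w.
Proof.
move=> [p]; elim: p u => [|e p IH] u /= => [->//|[<- evp] vw].
by have [q eq] := IH _ evp vw; exists (e :: q).
Qed.

Lemma linked_edge (e : edge G) : linked (esrc e) (etgt e).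
Proof. by exists [:: e]. Qed.

Lemma linked_sym u w : linked u w -> linked w u.
Proof.
move=> [p]; elim: p u => [|e p IH] u /= => [->|[<- /IH we]].
  exact: linked_refl.
apply: (linked_trans we).
by have := linked_edge (erev e); rewrite -src_rev revK src_rev.
Qed.

End Walks.

Section PeriodicTheory.
Context {R : realType} {d : nat}.
Variable G : lattice_graph R d.
Hypothesis Aunit : basis G \in unitmx.

Lemma cell_part_cell v : cell (basis G) (cell_part G v).
Proof.
apply/cellP => // s; rewrite /cell_part mulmxBl; set x := v *m _.
rewrite [(x - _) 0 s]mxE [X in _ + X]mxE latvec_coord // [cell_index _ _ _ _]mxE.
rewrite -/x subr_ge0 ltrBlDl; have /andP[-> /=] := floor_itv (x 0 s).
by rewrite intrD.
Qed.

Lemma cell_index_cell v : cell (basis G) v -> cell_index G v = 0.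
Proof.
move=> vcell; apply/eqP; rewrite -oppr_eq0; apply/eqP.
apply: (cell_uniq Aunit vcell); rewrite latvecN; exact: cell_part_cell.
Qed.

Lemma cell_indexD v n :
  cell_index G (v + latvec (basis G) n) = cell_index G v + n.
Proof.
apply/rowP => s; rewrite [RHS]mxE /cell_index ![(\row__ _) _ _]mxE mulmxDl.
set x := v *m _; rewrite [(x + _) 0 s]mxE latvec_coord //.
by rewrite floorDrz ?intr_int// intrKfloor.
Qed.

Lemma fund_edge_finite_of :
  (forall e : edge G, vert G (esrc e)) ->
  (forall v n, vert G v -> vert G (v + latvec (basis G) n)) ->
  (forall m n (e : edge G), eshift (m + n) e = eshift m (eshift n e)) ->
  (forall n (e : edge G), esrc (eshift n e) = esrc e + latvec (basis G) n) ->
  (forall v, vert G v -> finite_set [set e : edge G | esrc e = v]) ->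
  finite_set (fund_vert G) ->
  finite_set (range (@edge_orbit _ _ G)).
Proof.
move=> srcV shiftV shD srcS locf fvf.
have fin : finite_set (\bigcup_(v in fund_vert G) [set e : edge G | esrc e = v]).
  by apply: bigcup_finite => // v [] /locf.
apply: (sub_finite_set _ (finite_image (@edge_orbit _ _ G) fin)) => _ [e _ <-].
exists (eshift (- cell_index G (esrc e)) e).
  exists (esrc (eshift (- cell_index G (esrc e)) e)) => //; split; first exact: srcV.
  by rewrite srcS latvecN; exact: cell_part_cell.
apply/seteqP; split=> _ [n _ <-].
  by exists (n - cell_index G (esrc e)) => //; rewrite shD.
by exists (n + cell_index G (esrc e)) => //; rewrite -shD addrK.
Qed.

End PeriodicTheory.

(* Each Gamma-orbit of oriented edges contains exactly one edge starting in V_*. *)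
Lemma fund_edge_repr (R : realType) (d : nat) (G : lattice_graph R d) (e : edge G) :
  is_periodic_graph G ->
  exists! e', edge_orbit e e' /\ fund_vert G (esrc e').
Proof.
move=> hG; have Au := basis_unit hG.
exists (eshift (- cell_index G (esrc e)) e); split.
  split; first by exists (- cell_index G (esrc e)).
  split; first exact: src_vert hG _.
  by rewrite (src_shift hG) latvecN; exact: cell_part_cell.
move=> _ [[n _ <-] [_]]; rewrite (src_shift hG) => ncell; congr eshift.
apply/eqP; rewrite eq_sym -addr_eq0 addrC; apply/eqP.
by rewrite -cell_indexD // cell_index_cell.
Qed.

Section PerturbedPeriodic.
Context {R : realType} {d : nat}.
Variables (G : lattice_graph R d) (v1 v2 : 'rV[R]_d) (t : 'rV[int]_d).
Hypotheses (hG : is_periodic_graph G) (hv1 : vert G v1) (hv2 : vert G v2).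

Lemma perturbed_periodic : is_periodic_graph (perturbed_graph G v1 v2 t).
Proof.
have Au := basis_unit hG.
pose Gt := perturbed_graph G v1 v2 t.
have srcV (e : edge Gt) : vert G (esrc e).
  case: e => [e|[[] n]] /=; rewrite /pert_stop /pert_start;
    do ?apply: (vert_shift hG) => //.
  exact: src_vert hG _.
have shD m n (e : edge Gt) : eshift (m + n) e = eshift m (eshift n e).
  by case: e => [e|[c n']] /=; rewrite ?(shiftD hG) ?addrA.
have srcS n (e : edge Gt) : esrc (eshift n e) = esrc e + latvec (basis G) n.
  case: e => [e|[[] n']] /=; first exact: src_shift hG _ _.
  - by rewrite /pert_stop latvecD addrA addrAC.
  - by rewrite /pert_start latvecD addrA addrAC.
have locf v : vert G v -> finite_set [set e : edge Gt | esrc e = v].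
  move=> vV.
  have fin : finite_set
      ((inl @` [set e : edge G | esrc e = v]) `|`
       ((fun n => inr (false, n)) @` [set n | v1 + latvec (basis G) n = v]) `|`
       ((fun n => inr (true, n)) @`
          [set n | v2 + latvec (basis G) t + latvec (basis G) n = v])
       : set (edge Gt)).
    rewrite !finite_setU; split; first split.
    - by apply: finite_image; exact: locally_finite hG _ vV.
    - by apply: finite_image; exact: latvec_finite.
    - by apply: finite_image; exact: latvec_finite.
  apply: (sub_finite_set _ fin) => -[e|[[] n]] /= ev.
  - by left; left; exists e.
  - by right; exists n.
  - by left; right; exists n.
split=> //.
- case=> [e|[[] n]] /=; rewrite /pert_stop /pert_start;
    do ?apply: (vert_shift hG) => //.
  exact: tgt_vert hG _.
- by case=> [e|[c n]] /=; rewrite ?(revK hG) ?negbK.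
- by case=> [e|[[] n]] //= [/(rev_neq hG)].
- by case=> [e|[[] n]] //=; exact: src_rev hG _.
- exact: vert_shift hG.
- by case=> [e|[c n]] /=; rewrite ?(shift0 hG) ?add0r.
- move=> n [e|[[] n']] /=; first exact: tgt_shift hG _ _.
  + by rewrite /pert_start latvecD addrA addrAC.
  + by rewrite /pert_stop latvecD addrA addrAC.
- by move=> n [e|[c n']] /=; rewrite ?(rev_shift hG).
- exact: vert_infinite hG.
- move=> u w uV wV; have [p] := vert_connected hG uV wV.
  move=> pw; exists (map inl p); elim: p u pw {uV} => //= e p IH u [<- pw].
  by split=> //; exact: IH.
- exact: fund_vert_finite hG.
- apply: fund_edge_finite_of => //.
    exact: vert_shift hG.
  exact: fund_vert_finite hG.
Qed.

End PerturbedPeriodic.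

Section LimitPeriodic.
Context {R : realType} {d : nat}.
Variables (G : lattice_graph R d) (v1 v2 : 'rV[R]_d) (b : 'rV[R]_(d + 1)).
Hypotheses (hG : is_periodic_graph G) (bu : limit_basis G b \in unitmx).
Hypotheses (hv1 : vert G v1) (hv2 : vert G v2).
Let Gl := limit_graph G v1 v2 b.
Let A := basis G.

Lemma latvec_limit n :
  latvec (limit_basis G b) n =
  embed (latvec A (lsubmx n)) + (rsubmx n 0 0)%:~R *: b.
Proof.
rewrite /latvec /limit_basis -[in LHS](hsubmxK n) map_row_mx mul_row_col.
rewrite mul_mx_row mulmx0; congr (_ + _).
by rewrite [map_mx _ _]mx11_scalar mul_scalar_mx mxE.
Qed.

Lemma embedD (v w : 'rV[R]_d) : embed (v + w) = embed v + embed w.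
Proof. by rewrite /embed add_row_mx addr0. Qed.

Lemma limit_coord (v : 'rV[R]_d) (x : R) :
  (embed v + x *: b) *m invmx (limit_basis G b) = row_mx (v *m invmx A) x%:M.
Proof.
apply: (can_inj (mulmxK bu)); rewrite mulmxKV // /limit_basis mul_row_col.
by rewrite mul_mx_row mulmx0 mulmxKV ?(basis_unit hG) // mul_scalar_mx.
Qed.

Lemma limit_cell_index (v : 'rV[R]_d) (m : int) :
  cell_index Gl (embed v + m%:~R *: b) = row_mx (cell_index G v) m%:M.
Proof.
apply/rowP => s; rewrite mxE /= limit_coord.
case: (split_ordP s) => i ->; rewrite ?row_mxEl ?row_mxEr !mxE //.
by rewrite ord1 eqxx /= !mulr1n intrKfloor.
Qed.

Lemma limit_cell_part (v : 'rV[R]_d) (m : int) :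
  cell_part Gl (embed v + m%:~R *: b) = embed (cell_part G v).
Proof.
rewrite /cell_part limit_cell_index latvec_limit row_mxKl row_mxKr.
rewrite /= [m%:M 0 0]mxE eqxx mulr1n opprD addrACA subrr addr0.
apply: (addIr (embed (latvec A (cell_index G v)))).
by rewrite subrK -embedD subrK.
Qed.

Lemma limit_fund_vert : fund_vert Gl = embed @` fund_vert G.
Proof.
apply/seteqP; split=> [w [[v [m [vV ->]]] wc]|_ [v [vV vc] <-]].
  have := @cell_index_cell _ _ Gl bu _ wc; rewrite limit_cell_index.
  move=> /(congr1 rsubmx); rewrite row_mxKr => /matrixP/(_ 0 0).
  rewrite !mxE eqxx mulr1n => m0; move: wc; rewrite m0 scale0r addr0 => wc.
  exists v => //; split=> //; apply/cellP; first exact: basis_unit hG.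
  move=> s; have /cellP/(_ (lshift 1 s)) := wc; rewrite -[embed v]addr0.
  by rewrite -[X in _ + X](scale0r b) limit_coord row_mxEl; apply.
split; first by exists v, 0; rewrite scale0r addr0.
apply/cellP => // s; rewrite -[embed v]addr0 -[X in _ + X](scale0r b) limit_coord.
case: (split_ordP s) => i ->; rewrite ?row_mxEl ?row_mxEr.
  by have /cellP := vc; apply; exact: basis_unit hG.
by rewrite mxE ord1 eqxx mulr1n lexx ltr01.
Qed.

Lemma limit_potentialE (Q : 'rV[R]_d -> R) v :
  fund_vert G v -> limit_potential G v1 v2 b Q (embed v) = Q v.
Proof.
move=> [_ vc]; rewrite /limit_potential -[embed v]addr0 -[X in _ + X](scale0r b).
rewrite (limit_cell_part v 0) row_mxKl /cell_part.
by rewrite (cell_index_cell (basis_unit hG)) // latvec0 subr0.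
Qed.

Lemma limit_periodic : is_periodic_graph Gl.
Proof.
have Au := basis_unit hG.
have embV v m : vert G v -> vert Gl (embed v + m%:~R *: b) by move=> vV; exists v, m.
have shV v n : vert Gl v -> vert Gl (v + latvec (limit_basis G b) n).
  move=> [w [m [wV ->]]]; rewrite latvec_limit addrACA -embedD -scalerDl -intrD.
  by apply: embV; exact: vert_shift hG _ _ wV.
have v1V : vert Gl (embed v1) by have := embV _ 0 hv1; rewrite scale0r addr0.
have v2V : vert Gl (embed v2 + b) by have := embV _ 1 hv2; rewrite scale1r.
have srcV (e : edge Gl) : vert Gl (esrc e).
  case: e => [[e m]|[[] n]] /=; [|exact: shV|exact: shV].
  by apply: embV; exact: src_vert hG _.
have embS (v : 'rV_d) m n :
    embed (v + latvec A (lsubmx n)) + (rsubmx n 0 0 + m)%:~R *: b =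
    embed v + m%:~R *: b + latvec (limit_basis G b) n.
  by rewrite latvec_limit embedD intrD [_%:~R + _]addrC scalerDl addrACA.
have shD m n (e : edge Gl) : eshift (m + n) e = eshift m (eshift n e).
  case: e => [[e m']|[c n']] /=; last by rewrite addrA.
  rewrite -(shiftD hG); congr (inl (eshift _ _, _)); first by rewrite linearD.
  by rewrite linearD /= mxE addrA.
have srcS n (e : edge Gl) : esrc (eshift n e) = esrc e + latvec (limit_basis G b) n.
  case: e => [[e m]|[[] n']] /=.
  - by rewrite (src_shift hG) embS.
  - by rewrite /limit_stop latvecD addrA addrAC.
  - by rewrite /limit_start latvecD addrA addrAC.
have fvf : finite_set (fund_vert Gl).
  by rewrite limit_fund_vert; apply: finite_image; exact: fund_vert_finite hG.
have emb_inj v w m m' :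
    embed v + m%:~R *: b = embed w + m'%:~R *: b -> v = w /\ m = m'.
  move=> /(congr1 (fun x => x *m invmx (limit_basis G b))); rewrite /= !limit_coord.
  move=> /eq_row_mx[vw mm']; split.
    by apply: (can_inj (mulmxK (_ : invmx A \in unitmx))); rewrite ?unitmx_inv.
  have := congr1 (fun M : 'M[R]_1 => M 0 0) mm'.
  by rewrite !mxE eqxx !mulr1n => /intr_inj.
have locf v : vert Gl v -> finite_set [set e : edge Gl | esrc e = v].
  move=> [w [m [wV ->]]].
  have fin : finite_set
      (((fun e => inl (e, m)) @` [set e : edge G | esrc e = w]) `|`
       ((fun n => inr (false, n)) @` [set n | embed v1 + latvec (limit_basis G b) n = embed w + m%:~R *: b]) `|`
       ((fun n => inr (true, n)) @`
          [set n | embed v2 + b + latvec (limit_basis G b) n = embed w + m%:~R *: b])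
       : set (edge Gl)).
    rewrite !finite_setU; split; first split.
    - by apply: finite_image; exact: locally_finite hG _ wV.
    - by apply: finite_image; exact: latvec_finite.
    - by apply: finite_image; exact: latvec_finite.
  apply: (sub_finite_set _ fin) => -[[e m']|[[] n]] /= ev.
  - by left; left; have [ew ->] := emb_inj _ _ _ _ ev; exists e.
  - by right; exists n.
  - by left; right; exists n.
have rK (e : edge Gl) : erev (erev e) = e.
  by case: e => [[e m]|[c n]] /=; rewrite ?(revK hG) ?negbK.
have sR (e : edge Gl) : esrc (erev e) = etgt e.
  by case: e => [[e m]|[[] n]] //=; rewrite (src_rev hG).
split=> //.
- by move=> e; rewrite -sR; exact: srcV.
- by case=> [[e m]|[[] n]] //= [/(rev_neq hG)].
- case=> [[e m]|[c n]] /=; last by rewrite add0r.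
  by rewrite !linear0 mxE add0r (shift0 hG).
- move=> n [[e m]|[[] n']] /=.
  + by rewrite (tgt_shift hG) embS.
  + by rewrite /limit_start latvecD addrA addrAC.
  + by rewrite /limit_stop latvecD addrA addrAC.
- by move=> n [[e m]|[c n']] /=; rewrite ?(rev_shift hG).
- move=> Vfin; apply: (vert_infinite hG).
  apply: (sub_finite_set _ (finite_image lsubmx Vfin)) => v vV.
  by exists (embed v); [have := embV _ 0 vV; rewrite scale0r addr0|rewrite row_mxKl].
- have layer u w m : vert G u -> vert G w ->
      linked Gl (embed u + m%:~R *: b) (embed w + m%:~R *: b).
    move=> uV wV; have [p pw] := vert_connected hG uV wV.
    exists (map (fun e => inl (e, m)) p); elim: p u pw {uV} => [|e p IH] u /=.
      by move=> ->.
    by move=> [<- pw]; split=> //; exact: IH.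
  have up m : linked Gl (embed v1 + m%:~R *: b) (embed v1 + (m + 1)%:~R *: b).
    pose n : 'rV[int]_(d + 1) := row_mx 0 m%:M.
    have Ln : latvec (limit_basis G b) n = m%:~R *: b.
      rewrite latvec_limit row_mxKl row_mxKr latvec0 [m%:M 0 0]mxE eqxx mulr1n.
      by rewrite /embed row_mx0 add0r.
    apply: (linked_trans _ (layer v2 v1 (m + 1) hv2 hv1)).
    have := linked_edge (inr (false, n) : edge Gl).
    rewrite /= /limit_start /limit_stop Ln -addrA.
    by rewrite intrD scalerDl scale1r [b + _]addrC.
  have ups m (k : nat) : linked Gl (embed v1 + m%:~R *: b) (embed v1 + (m + k%:Z)%:~R *: b).
    elim: k => [|k IH]; first by rewrite addr0; exact: linked_refl.
    by apply: (linked_trans IH); rewrite -[k.+1]addn1 PoszD addrA; exact: up.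
  have all m m' : linked Gl (embed v1 + m%:~R *: b) (embed v1 + m'%:~R *: b).
    case: (lerP m m') => [mm'|/ltW mm']; last apply: linked_sym => //.
      by have := ups m `|m' - m|%N; rewrite gez0_abs ?subr_ge0 // [m + _]addrC subrK.
    by have := ups m' `|m - m'|%N; rewrite gez0_abs ?subr_ge0 // [m' + _]addrC subrK.
  move=> _ _ [u [m [uV ->]]] [w [m' [wV ->]]].
  apply: linked_trans (layer _ _ _ uV hv1) _.
  by apply: linked_trans (all m m') (layer _ _ _ hv1 wV).
- exact: fund_edge_finite_of.
Qed.

End LimitPeriodic.

(* The indices of the edges of the perturbed graph and of the limit graph. *)
Section Indices.
Context {R : realType} {d : nat}.
Variables (G : lattice_graph R d) (v1 v2 : 'rV[R]_d).
Hypotheses (hG : is_periodic_graph G) (hv1 : fund_vert G v1) (hv2 : fund_vert G v2).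

Lemma perturbed_index t (e : edge G) :
  edge_index (inl e : edge (perturbed_graph G v1 v2 t)) = edge_index e.
Proof. by []. Qed.

Lemma perturbed_new_index t n :
  edge_index (inr (false, n) : edge (perturbed_graph G v1 v2 t)) = t.
Proof.
have Au : basis (perturbed_graph G v1 v2 t) \in unitmx := basis_unit hG.
rewrite /edge_index /= /pert_stop /pert_start !(cell_indexD Au).
by rewrite !(cell_index_cell Au) ?add0r ?addrK //; [case: hv1|case: hv2].
Qed.

Variable b : 'rV[R]_(d + 1).
Hypothesis bu : limit_basis G b \in unitmx.

Lemma limit_index (e : edge G) m :
  edge_index (inl (e, m) : edge (limit_graph G v1 v2 b)) =
  row_mx (edge_index e) 0.
Proof.
rewrite /edge_index /= !(limit_cell_index _ _ hG bu).
by rewrite opp_row_mx add_row_mx subrr.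
Qed.

Lemma limit_new_index n :
  edge_index (inr (false, n) : edge (limit_graph G v1 v2 b)) = row_mx 0 1%:M.
Proof.
have Au : basis (limit_graph G v1 v2 b) \in unitmx := bu.
rewrite /edge_index /= /limit_stop /limit_start !(cell_indexD Au).
have := limit_cell_index v1 v2 hG bu v2 1; rewrite scale1r => ->.
have := limit_cell_index v1 v2 hG bu v1 0; rewrite scale0r addr0 => ->.
rewrite !(cell_index_cell (basis_unit hG)); [|by case: hv1|by case: hv2].
by rewrite opprD addrACA subrr addr0 opp_row_mx add_row_mx subr0 raddf0 subr0.
Qed.

End Indices.

(* Main.v *)
(* The fiber operator of the perturbed graph at k is the fiber operator of the limit
   graph at (k, <t, k>), up to the enumeration of the vertices. Hence the band functions
   of G_t are those of the limit graph restricted to the subtorus k_{d+1} = <t, k>, and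
   the two band edges agree iff the extremum over the whole torus is attained on this
   subtorus. That the extrema are attained follows from the compactness of the set of
   pairs (k, sorted spectrum of H(k)). *)
Require Import Defs.
From mathcomp Require Import all_boot all_order all_algebra perm finmap.
From mathcomp Require Import all_classical all_reals all_analysis complex.
(* MathComp-Analysis also has a [basis]; the one of a lattice graph is meant below. *)
Import Defs.

Set Implicit Arguments.
Unset Strict Implicit.
Unset Printing Implicit Defensive.

Import Order.TTheory GRing.Theory Num.Theory.
Import numFieldNormedType.Exports.

Local Open Scope classical_set_scope.
Local Open Scope ring_scope.

(** * Polynomials depending continuously on a parameter *)

Section ComplexContinuity.
Context {R : realType} {T : topologicalType}.
Implicit Types (f g : T -> R[i]) (p q : T -> {poly R[i]}).

(** Stated through real and imaginary parts, so that only continuity of real-valued functions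
    enters. *)
Definition complex_continuous f : Prop :=
  continuous (@complex.Re R \o f) /\ continuous (@complex.Im R \o f).

Lemma complex_continuous_cst c : complex_continuous (fun=> c).
Proof. by split=> x; exact: cvg_cst. Qed.

Lemma complex_continuousD f g : complex_continuous f -> complex_continuous g ->
  complex_continuous (fun x => f x + g x).
Proof.
move=> [rf mf] [rg mg]; split=> x.
  have -> : @complex.Re R \o (fun x => f x + g x) =
      (@complex.Re R \o f) \+ (@complex.Re R \o g).
    by apply/funext => y /=; rewrite raddfD.
  by apply: (@continuousD _ R^o); [exact: rf|exact: rg].
have -> : @complex.Im R \o (fun x => f x + g x) =
    (@complex.Im R \o f) \+ (@complex.Im R \o g).
  by apply/funext => y /=; rewrite raddfD.
by apply: (@continuousD _ R^o); [exact: mf|exact: mg].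
Qed.

Lemma complex_continuousM f g : complex_continuous f -> complex_continuous g ->
  complex_continuous (fun x => f x * g x).
Proof.
move=> [rf mf] [rg mg]; split=> x.
  have -> : @complex.Re R \o (fun x => f x * g x) =
      ((@complex.Re R \o f) \* (@complex.Re R \o g)) \-
      ((@complex.Im R \o f) \* (@complex.Im R \o g)).
    by apply/funext => y /=; case: (f y) (g y) => [a b] [c e].
  apply: (@continuousB _ R^o); apply: continuousM;
  by [exact: rf|exact: rg|exact: mf|exact: mg].
have -> : @complex.Im R \o (fun x => f x * g x) =
    ((@complex.Re R \o f) \* (@complex.Im R \o g)) \+
    ((@complex.Im R \o f) \* (@complex.Re R \o g)).
  by apply/funext => y /=; case: (f y) (g y) => [a b] [c e] /=.
apply: (@continuousD _ R^o); apply: continuousM;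
by [exact: rf|exact: rg|exact: mf|exact: mg].
Qed.

Lemma complex_continuous_sum (I : Type) (r : seq I) (P : pred I) (F : I -> T -> R[i]) :
  (forall i, complex_continuous (F i)) ->
  complex_continuous (fun x => \sum_(i <- r | P i) F i x).
Proof.
move=> Fc; elim: r => [|i r IH].
  under eq_fun do rewrite big_nil; exact: complex_continuous_cst.
under eq_fun do rewrite big_cons.
by case: (P i) => //; exact: complex_continuousD.
Qed.

(** Coefficientwise and without a degree bound; products are harmless, since each of their
    coefficients is a finite sum of products. *)
Definition poly_continuous p : Prop := forall i, complex_continuous (fun x => (p x)`_i).

Lemma poly_continuous_cst c : poly_continuous (fun=> c).
Proof. by move=> i; exact: complex_continuous_cst. Qed.

Lemma poly_continuousC f : complex_continuous f -> poly_continuous (fun x => (f x)%:P).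
Proof.
move=> fc [|i]; under eq_fun do rewrite coefC /=; first exact: fc.
exact: complex_continuous_cst.
Qed.

Lemma poly_continuousD p q : poly_continuous p -> poly_continuous q ->
  poly_continuous (fun x => p x + q x).
Proof.
by move=> pc qc i; under eq_fun do rewrite coefD; exact: complex_continuousD.
Qed.

Lemma poly_continuousM p q : poly_continuous p -> poly_continuous q ->
  poly_continuous (fun x => p x * q x).
Proof.
move=> pc qc i; under eq_fun do rewrite coefM.
by apply: complex_continuous_sum => l; exact: complex_continuousM.
Qed.

Lemma poly_continuousB p q : poly_continuous p -> poly_continuous q ->
  poly_continuous (fun x => p x - q x).
Proof.
move=> pc qc; apply: poly_continuousD => //.
under eq_fun do rewrite -mulN1r.
by apply: poly_continuousM => //; exact: poly_continuous_cst.
Qed.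

Lemma poly_continuous_sum (I : Type) (r : seq I) (P : pred I) (F : I -> T -> {poly R[i]}) :
  (forall i, poly_continuous (F i)) ->
  poly_continuous (fun x => \sum_(i <- r | P i) F i x).
Proof.
move=> Fc i; under eq_fun do rewrite coef_sum.
by apply: complex_continuous_sum => l; exact: Fc.
Qed.

Lemma poly_continuous_prod (I : Type) (r : seq I) (P : pred I) (F : I -> T -> {poly R[i]}) :
  (forall i, poly_continuous (F i)) ->
  poly_continuous (fun x => \prod_(i <- r | P i) F i x).
Proof.
move=> Fc; elim: r => [|i r IH].
  under eq_fun do rewrite big_nil; exact: poly_continuous_cst.
under eq_fun do rewrite big_cons.
by case: (P i) => //; exact: poly_continuousM.
Qed.

Lemma poly_continuous_XsubC f :
  complex_continuous f -> poly_continuous (fun x => 'X - (f x)%:P).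
Proof.
move=> fc; apply: poly_continuousB; first exact: poly_continuous_cst.
exact: poly_continuousC.
Qed.

(** Leibniz formula: the determinant is built from the entries by sums and products. *)
Lemma char_poly_continuous n (M : T -> 'M[R[i]]_n) :
  (forall i j, complex_continuous (fun x => M x i j)) ->
  poly_continuous (fun x => char_poly (M x)).
Proof.
move=> Mc; rewrite /char_poly /determinant.
apply: poly_continuous_sum => s; apply: poly_continuousM.
  exact: poly_continuous_cst.
apply: poly_continuous_prod => i; under eq_fun do rewrite !mxE.
apply: poly_continuousB; first exact: poly_continuous_cst.
exact/poly_continuousC/Mc.
Qed.

(** Equality of polynomials is an intersection of closed conditions, two real ones for each
    coefficient. *)
Lemma closed_eq_poly p q :
  poly_continuous p -> poly_continuous q -> closed [set x | p x = q x].
Proof.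
move=> pc qc; have cE (f g : T -> R) : continuous f -> continuous g ->
    closed [set x | f x = g x].
  move=> fc gc.
  have -> : [set x | f x = g x] = (f \- g) @^-1` [set y | y = 0].
    by apply/seteqP; split=> x /=; [move=> ->; rewrite subrr|move/subr0_eq].
  apply: closed_comp; last exact: closed_eq.
  by move=> x _; apply: (@continuousB _ R^o); [exact: fc|exact: gc].
have -> : [set x | p x = q x] = \bigcap_(i in [set: nat])
    ([set x | (@complex.Re R \o (fun x => (p x)`_i)) x = (@complex.Re R \o (fun x => (q x)`_i)) x] `&`
     [set x | (@complex.Im R \o (fun x => (p x)`_i)) x = (@complex.Im R \o (fun x => (q x)`_i)) x]).
  apply/seteqP; split=> x /=; first by move=> pq i _ /=; rewrite pq.
  move=> pq; apply/polyP => i; have [/=] := pq i I.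
  by case: (_`_i) (_`_i) => [a b] [c e] /= -> ->.
apply: closed_bigI => i _; apply: closedI; apply: cE.
- by case: (pc i).
- by case: (qc i).
- by case: (pc i).
- by case: (qc i).
Qed.

End ComplexContinuity.

(** * Extrema of sorted eigenvalues *)

Section Eigenvalues.
Context {C : numClosedFieldType} {n : nat}.
Implicit Types A : 'M[C]_n.

Lemma char_poly_eigenvalues A :
  char_poly A = \prod_(z <- eigenvalues A) ('X - z%:P).
Proof.
rewrite /eigenvalues; case: closed_field_poly_normal => s /= sE.
by rewrite {1}sE (monicP (char_poly_monic A)) scale1r.
Qed.

Lemma size_eigenvalues A : size (eigenvalues A) = n.
Proof.
by have := size_char_poly A; rewrite char_poly_eigenvalues size_prod_XsubC => -[].
Qed.

(** For a left eigenvector [v], sum [|z| |v_j| <= sum_i |v_i| |A_ij|] over [j] and divide by the l1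
    norm of [v]. The bound is crude, but it is controlled continuously by the entries. *)
Lemma norm_eigenvalue_le A z :
  z \in eigenvalues A -> `|z| <= \sum_i \sum_j `|A i j|.
Proof.
move=> zA; have /eigenvalueP[v vA v0] : eigenvalue A z.
  by rewrite eigenvalue_root_char char_poly_eigenvalues root_prod_XsubC.
have [i vi0] : exists i, v 0 i != 0.
  apply/existsP; apply: contraNT v0; rewrite negb_exists => /forallP v0.
  by apply/eqP/rowP => i; have := v0 i; rewrite negbK mxE => /eqP.
have v_gt0 : 0 < \sum_i `|v 0 i|.
  rewrite (bigD1 i) //= ltr_pwDl ?normr_gt0 //.
  by apply: sumr_ge0 => j _; exact: normr_ge0.
rewrite -(ler_pM2r v_gt0) mulr_sumr.
have /ler_sum : forall j, true -> `|z| * `|v 0 j| <= \sum_i `|v 0 i| * `|A i j|.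
  move=> j _; rewrite -normrM.
  have -> : z * v 0 j = \sum_i v 0 i * A i j.
    by have := congr1 (fun w : 'rV_n => w 0 j) vA; rewrite !mxE => ->.
  apply: le_trans (ler_norm_sum _ _ _) _; apply: ler_sum => l _.
  by rewrite normrM.
move=> /(_ (index_enum _)) /le_trans; apply.
rewrite exchange_big /= mulr_suml; apply: ler_sum => l _.
rewrite -mulr_sumr mulrC; apply: ler_wpM2l.
  by apply: sumr_ge0 => j _; exact: normr_ge0.
rewrite (bigD1 l) //= lerDl; apply: sumr_ge0 => j _; exact: normr_ge0.
Qed.

End Eigenvalues.

Section Extremum.
Context {R : realType}.
Implicit Types (S : set R) (x y : R) (side : band_side).

Definition side_le side x y : Prop :=
  match side with Lower => x <= y | Upper => y <= x end.

Definition side_extremum side S x : Prop := S x /\ forall y, S y -> side_le side x y.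

Lemma side_le_anti side x y : side_le side x y -> side_le side y x -> x = y.
Proof. by case: side => /= xy yx; apply/eqP; rewrite eq_le xy yx. Qed.

(** [set_min] and [set_max] fall back to 0 when there is no extremum; existence excludes this
    default. *)
Lemma band_edge_extremum d (G : lattice_graph R d) Q j side :
  (exists x, side_extremum side (band_fun G Q j @` torus) x) ->
  side_extremum side (band_fun G Q j @` torus) (band_edge side G Q j).
Proof.
case: side => -[x [Sx xS]]; rewrite /band_edge /set_min /set_max.
  by case: xgetP => [y _ []|/(_ x)[]].
by case: xgetP => [y _ []|/(_ x)[]].
Qed.

End Extremum.

(** A compact set containing the half-open [torus]; extrema are found here and then moved to [torus]
    by periodicity. *)
Definition box {R : realType} {d : nat} : set 'rV[R]_d :=
  [set k | forall s, - pi <= k 0 s <= pi].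

Lemma box_compact (R : realType) (d : nat) : compact (@box R d).
Proof.
have := @rV_compact R d (fun=> `[- pi, pi]%classic) (fun=> @segment_compact _ _ _).
rewrite (_ : [set _ | _] = box) //.
Qed.

Section ComplexNorm.
Context {R : realType}.

Lemma normci : `|'i%C : R[i]| = 1.
Proof. by rewrite normc_def /= expr0n add0r expr1n sqrtr1. Qed.

Lemma normc_real (x : R) : `|x%:C%C| = `|x|%:C%C.
Proof. by rewrite normc_def /= expr0n addr0 sqrtr_sqr. Qed.

Lemma normc_ge_Im (z : R[i]) : `|complex.Im z|%:C%C <= `|z|.
Proof.
have := normc_ge_Re (z * 'i%C).
by rewrite ReiNIm normrN normrM normci mulr1.
Qed.

Lemma normc_le_Re_Im (z : R[i]) : `|z| <= (`|complex.Re z| + `|complex.Im z|)%:C%C.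
Proof.
rewrite {1}[z]complexE rmorphD /=; apply: le_trans (ler_normD _ _) _.
by rewrite normrM normci mul1r !normc_real.
Qed.

End ComplexNorm.

(** * Compactness of the set of sorted spectra *)

Section SortedRoots.
Context {R : realType} {m n : nat}.
Variable M : 'rV[R]_m -> 'M[R[i]]_n.
Hypothesis Mc : forall i j, complex_continuous (fun k => M k i j).

(** For [A] a fiber matrix this is [band_fun], with the bands counted from 0. *)
Definition re_eigenvalue (A : 'M[R[i]]_n) (j : nat) : R :=
  nth 0 (sort <=%R [seq complex.Re z | z <- eigenvalues A]) j.

(** The spectrum of [M k] is bounded by a continuous function of [k], which has a maximum on the
    compact box. *)
Lemma eigenvalues_bounded : exists B : R, forall k z, box k ->
  z \in eigenvalues (M k) -> `|complex.Re z| <= B /\ `|complex.Im z| <= B.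
Proof.
pose g k := \sum_i \sum_j (`|complex.Re (M k i j)| + `|complex.Im (M k i j)|).
have gc : continuous g.
  rewrite /g; apply: continuous_big; first exact: add_continuous.
  move=> i _; apply: continuous_big; first exact: add_continuous.
  move=> j _ x; have [rc ic] := Mc i j.
  apply: (@continuousD _ R^o _ (fun k => `|complex.Re (M k i j)|)
    (fun k => `|complex.Im (M k i j)|)).
    apply: (@continuous_comp _ _ _ (fun k => complex.Re (M k i j)) Num.norm).
      exact: rc.
    exact: norm_continuous.
  apply: (@continuous_comp _ _ _ (fun k => complex.Im (M k i j)) Num.norm).
    exact: ic.
  exact: norm_continuous.
have box0 : @box R m !=set0.
  by exists 0 => s; rewrite mxE oppr_le0 pi_ge0.
have [c _ cmax] := EVT_max_rV box0 (@box_compact R m) (continuous_subspaceT gc).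
exists (g c) => k z kb zk.
have zg : `|z| <= (g c)%:C%C.
  apply: le_trans (norm_eigenvalue_le zk) _.
  apply: (@le_trans _ _ (g k)%:C%C); last first.
    by rewrite lecR; apply: cmax; rewrite inE.
  rewrite /g rmorph_sum /=; apply: ler_sum => i _.
  rewrite rmorph_sum /=; apply: ler_sum => j _; exact: normc_le_Re_Im.
split; rewrite -lecR.
  exact: le_trans (normc_ge_Re _) zg.
exact: le_trans (normc_ge_Im _) zg.
Qed.

(** A parameter followed by the real parts and the imaginary parts of [n] roots, flattened into one
    real row vector so that bounded closed sets are compact. *)
Let T := 'rV[R]_(m + (n + n)).
Let kpart (x : T) : 'rV[R]_m := lsubmx x.
Let repart (x : T) (i : 'I_n) : R := x 0 (rshift m (lshift n i)).
Let impart (x : T) (i : 'I_n) : R := x 0 (rshift m (rshift n i)).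

Let sorted_roots : set T :=
  [set x | (forall i j : 'I_n, (i <= j)%N -> repart x i <= repart x j) /\
     char_poly (M (kpart x)) =
       \prod_(i < n) ('X - (Complex (repart x i) (impart x i))%:P)].

Let repart_cont i : continuous (fun x => repart x i).
Proof. exact: coord_continuous. Qed.

Let impart_cont i : continuous (fun x => impart x i).
Proof. exact: coord_continuous. Qed.

Let kpart_cont : continuous kpart.
Proof.
move=> x A /= /(nbhs_ballP (kpart x))[e e0 eA].
apply/nbhs_ballP; exists e => //= y [_ xy]; apply: eA; split=> // i s.
by rewrite !mxE; exact: xy.
Qed.

(** Weak inequalities between coordinates are closed conditions, and so is the factorization, by
    [closed_eq_poly]. *)
Let sorted_roots_closed : closed sorted_roots.
Proof.
have -> : sorted_roots =
    (\bigcap_(ij in [set ij : 'I_n * 'I_n | (ij.1 <= ij.2)%N])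
       [set x | repart x ij.1 <= repart x ij.2]) `&`
    [set x | char_poly (M (kpart x)) =
       \prod_(i < n) ('X - (Complex (repart x i) (impart x i))%:P)].
  apply/seteqP; split=> x [xs xE]; split=> //.
    by move=> [i j] /=; exact: xs.
  by move=> i j ij; exact: (xs (i, j)).
apply: closedI.
  apply: closed_bigI => -[i j] _ /=.
  have -> : [set x | repart x i <= repart x j] =
      ((repart ^~ j) \- (repart ^~ i)) @^-1` [set y | 0 <= y].
    by apply/seteqP; split=> x /=; rewrite subr_ge0.
  apply: closed_comp; last exact: closed_ge.
  by move=> x _; apply: (@continuousB _ R^o); exact: repart_cont.
apply: closed_eq_poly.
  apply: char_poly_continuous => i j; have [rc ic] := Mc i j.
  split=> x; apply: (@continuous_comp _ _ _ kpart (fun k => _ (M k i j)));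
    by [exact: kpart_cont|exact: rc|exact: ic].
apply: poly_continuous_prod => i; apply: poly_continuous_XsubC.
by split=> x; [exact: repart_cont|exact: impart_cont].
Qed.

(** By unique factorization the listed roots are the eigenvalues up to order. Their real parts are
    already sorted, so ties do not matter. *)
Let repart_eigenvalue x (j : 'I_n) :
  sorted_roots x -> repart x j = re_eigenvalue (M (kpart x)) j.
Proof.
move=> [xs xE]; pose zs := [seq Complex (repart x i) (impart x i) | i <- enum 'I_n].
have pe : perm_eq (eigenvalues (M (kpart x))) zs.
  by apply: prod_XsubC_eq; rewrite -char_poly_eigenvalues xE big_map big_enum.
rewrite /re_eigenvalue.
have -> : sort <=%R [seq complex.Re z | z <- eigenvalues (M (kpart x))] =
    [seq complex.Re z | z <- zs].
  rewrite (perm_sortP _ _ _ _ _ (perm_map _ pe)); [|exact: le_total|exact: le_trans|exact: le_anti].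
  apply: sorted_sort; first exact: le_trans.
  rewrite -map_comp; apply: (@homo_sorted _ _ _ (fun i k : 'I_n => (i <= k)%N)).
    by move=> i k; exact: xs.
  have := iota_sorted 0 n; rewrite -val_enum_ord sorted_map.
  by apply: sub_sorted.
by rewrite -map_comp (nth_map j) ?size_enum_ord //= nth_ord_enum.
Qed.

Let sorted_roots_ex k : exists2 x, sorted_roots x & kpart x = k /\
  forall i, Complex (repart x i) (impart x i) \in eigenvalues (M k).
Proof.
(* Sorting the complex roots, rather than their real parts, keeps each imaginary part with its real
   part. *)
pose le_re (z w : R[i]) := complex.Re z <= complex.Re w.
pose zs := sort le_re (eigenvalues (M k)).
have sz : size zs = n by rewrite size_sort size_eigenvalues.
pose x : T := row_mx k (row_mx (\row_i complex.Re zs`_i) (\row_i complex.Im zs`_i)).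
have kx : kpart x = k by rewrite /kpart row_mxKl.
have zx i : Complex (repart x i) (impart x i) = zs`_i.
  rewrite /repart /impart /x !row_mxEr row_mxEl !mxE.
  by case: (zs`_i).
exists x; last first.
  split=> // i; rewrite zx.
  have : zs`_i \in zs by rewrite mem_nth // sz.
  by rewrite mem_sort.
split.
  move=> i j ij; have := congr1 (@complex.Re R) (zx i) => /= ->.
  have := congr1 (@complex.Re R) (zx j) => /= ->.
  apply: (@sorted_leq_nth _ le_re); rewrite ?inE ?sz //.
  - by move=> a b c; exact: le_trans.
  - by move=> a; exact: lexx.
  - by apply: sort_sorted => a b; exact: le_total.
rewrite kx char_poly_eigenvalues.
under [RHS]eq_bigr do rewrite zx.
rewrite (perm_big zs) /=; last by rewrite perm_sym /zs perm_sort.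
by rewrite (big_nth 0) sz big_mkord.
Qed.

(* The tuples (k, z_1, ..., z_n) in which z_1, ..., z_n are the roots of the
   characteristic polynomial of M k, sorted by real part, form a compact set on
   which Re z_j is a coordinate; the branches need not be known to be continuous. *)
Lemma re_eigenvalue_extremum (side : band_side) (j : nat) : (j < n)%N ->
  exists x, side_extremum side ((fun k => re_eigenvalue (M k) j) @` box) x.
Proof.
move=> jn; pose jo := Ordinal jn.
have [B BP] := eigenvalues_bounded.
(* [pi] bounds the coordinates of [k] in the box, [B] those of the roots. *)
pose bnd : set T := [set x : T | forall s, `|x 0 s| <= Num.max pi B].
have bnd_compact : compact bnd.
  have := @rV_compact R (m + (n + n)) (fun=> `[- Num.max pi B, Num.max pi B]%classic)
    (fun=> @segment_compact _ _ _).
  congr compact; apply/seteqP; split=> x /= xb s; have := xb s;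
    by rewrite /= in_itv /= ler_norml.
pose S := sorted_roots `&` bnd `&` (kpart @^-1` box).
(* The values of the branch over the box are the values of one coordinate on [S], to which the
   extreme value theorem applies. *)
have imS : (fun x => repart x jo) @` S = (fun k => re_eigenvalue (M k) j) @` box.
  apply/seteqP; split=> [_ [x [[xs _] xb] <-]|_ [k kb <-]].
    by exists (kpart x) => //; have /= -> := repart_eigenvalue jo xs.
  have [x xs [kx zx]] := sorted_roots_ex k.
  exists x; last by have /= -> := repart_eigenvalue jo xs; rewrite kx.
  split; last by rewrite /= kx.
  split=> // s; rewrite le_max; case: (split_ordP s) => [s' ->|s' ->].
    have := kb s'; rewrite -kx mxE => kbs.
    by rewrite ler_norml kbs.
  by case: (split_ordP s') => i ->; have [rb ib] := BP _ _ kb (zx i);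
    [rewrite rb orbT|rewrite ib orbT].
have Sc : compact S.
  apply: (subclosed_compact _ bnd_compact); last by move=> x [[]].
  apply: closedI; first apply: closedI.
  - exact: sorted_roots_closed.
  - exact: (compact_closed (@norm_hausdorff _ _) bnd_compact).
  - apply: closed_comp; first by move=> x _; exact: kpart_cont.
    exact: (compact_closed (@norm_hausdorff _ _) (@box_compact R m)).
have S0 : S !=set0.
  have : box (0 : 'rV[R]_m) by move=> s; rewrite mxE oppr_le0 pi_ge0.
  have /= : ((fun k => re_eigenvalue (M k) j) @` box) (re_eigenvalue (M 0) j) -> S !=set0.
    by rewrite -imS => -[x xS _]; exists x.
  by move=> h b0; apply: h; exists 0.
have rc := @continuous_subspaceT _ _ S _ (@repart_cont jo).
rewrite -imS; case: side.
  have [c cS cm] := EVT_min_rV S0 Sc rc; exists (repart c jo); split.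
    by exists c => //; rewrite inE in cS.
  by move=> _ [x xS <-]; apply: cm; rewrite inE.
have [c cS cm] := EVT_max_rV S0 Sc rc; exists (repart c jo); split.
  by exists c => //; rewrite inE in cS.
by move=> _ [x xS <-]; apply: cm; rewrite inE.
Qed.

End SortedRoots.

(** * Band functions on the torus *)

Section Periodicity.
Context {R : realType}.
Implicit Types x y : R.

Lemma expi_period x y : eq_mod_2pi x y -> expi x = expi y.
Proof.
have expiP (n : nat) z : expi (z + n%:R * (2 * pi)) = expi z :> R[i].
  rewrite mulr_natl (mulr_natl pi 2) /expi.
  by rewrite (periodicn (@cosD2pi R)) (periodicn (@sinD2pi R)).
move=> [[n|n] xy].
  by rewrite -(subrK y x) xy addrC expiP.
by rewrite -(subrK x y) -opprB xy NegzE mulrNz mulNr opprK addrC expiP.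
Qed.

Lemma eq_mod_2pi_refl x : eq_mod_2pi x x.
Proof. by exists 0; rewrite subrr mul0r. Qed.

Lemma eq_mod_2pi_sym x y : eq_mod_2pi x y -> eq_mod_2pi y x.
Proof. by move=> [m xy]; exists (- m); rewrite mulrNz mulNr -xy opprB. Qed.

(** The coefficients of [n] are integers, so [phase n] descends to the torus. *)
Lemma eq_mod_2pi_phase d (n : 'rV[int]_d) (k k' : 'rV[R]_d) :
  (forall s, eq_mod_2pi (k 0 s) (k' 0 s)) -> eq_mod_2pi (phase n k) (phase n k').
Proof.
move=> kk'; have [m mE] := choice kk'.
exists (\sum_s n 0 s * m s); rewrite /phase -sumrB rmorph_sum /= mulr_suml.
by apply: eq_bigr => s _; rewrite -mulrBr mE intrM mulrA.
Qed.

Lemma torus_repr d (k : 'rV[R]_d) :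
  exists2 k', torus k' & forall s, eq_mod_2pi (k' 0 s) (k 0 s).
Proof.
have P2 : 0 < 2 * pi :> R by rewrite mulr_gt0 // pi_gt0.
(* The ceiling, and not the floor, because the interval from [- pi] to [pi] is closed on the
   right. *)
exists (\row_s (k 0 s - (Num.ceil ((k 0 s - pi) / (2 * pi)))%:~R * (2 * pi))).
  move=> s; rewrite mxE; set y := _ / _.
  have -> : k 0 s = y * (2 * pi) + pi by rewrite /y divfK ?gt_eqF // subrK.
  have /andP[y1 y2] := ceil_itv y; rewrite addrAC -mulrBl.
  apply/andP; split.
    rewrite -subr_gt0 opprK -addrA -mulr2n -(mulr_natl pi) -{2}[2 * pi]mul1r -mulrDl.
    by rewrite pmulr_lgt0 // addrAC subr_gt0 -ltrBlDr; rewrite intrB in y1.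
  by rewrite gerDr pmulr_lle0 // subr_le0.
move=> s; rewrite mxE; exists (- Num.ceil ((k 0 s - pi) / (2 * pi))).
by rewrite addrAC subrr add0r mulrNz mulNr.
Qed.

End Periodicity.

Section BandFunctions.
Context {R : realType} {d : nat}.
Variables (G : lattice_graph R d) (Q : 'rV[R]_d -> R).

Lemma band_fun_period j (k k' : 'rV[R]_d) :
  (forall s, eq_mod_2pi (k 0 s) (k' 0 s)) -> band_fun G Q j k = band_fun G Q j k'.
Proof.
move=> kk'; rewrite /band_fun; suff -> : fiber_mx G Q k = fiber_mx G Q k' by [].
apply/matrixP => i l; rewrite !mxE /fiber_op; congr (_ + _).
by apply: eq_fsbigr => e _; rewrite (expi_period (eq_mod_2pi_phase _ kk')).
Qed.

(** Lets unreduced points such as [(k, <t, k>)] be compared with the extrema over [torus]. *)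
Lemma band_fun_torus j k : (band_fun G Q j @` torus) (band_fun G Q j k).
Proof.
by have [k' k't kk'] := torus_repr k; exists k'; [|exact: band_fun_period].
Qed.

Hypothesis hG : is_periodic_graph G.

Lemma fund_nth_vert i : (i < nu G)%N -> fund_vert G (fund_nth G i).
Proof.
move=> inu; have : fund_nth G i \in fset_set (fund_vert G) by exact: mem_nth.
by rewrite in_fset_set ?inE //; exact: fund_vert_finite hG.
Qed.

(** By local finiteness each entry is a finite sum over an edge set that does not depend on [k]. *)
Lemma fiber_mx_continuous i j : complex_continuous (fun k => fiber_mx G Q k i j).
Proof.
under eq_fun do rewrite mxE /fiber_op.
have efin : finite_set [set e : edge G | esrc e = fund_nth G i].
  by apply: locally_finite hG _ _; case: (fund_nth_vert (ltn_ord i)).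
under eq_fun do rewrite (fsbig_finite _ _ efin) /=.
apply: complex_continuousD; last exact: complex_continuous_cst.
apply: complex_continuous_sum => e.
apply: complex_continuousD; first exact: complex_continuous_cst.
under eq_fun do rewrite -mulrN.
apply: complex_continuousM; last exact: complex_continuous_cst.
have phc : continuous (fun k : 'rV[R]_d => phase (edge_index e) k).
  rewrite /phase; apply: continuous_big; first exact: add_continuous.
  move=> s _ k; apply: (@continuousM _ _ (fun=> _) (fun k : 'rV[R]_d => k 0 s)).
    exact: cst_continuous.
  exact: coord_continuous.
split=> k.
  apply: (@continuous_comp _ _ _ (phase (edge_index e)) cos); first exact: phc.
  exact: continuous_cos.
apply: (@continuous_comp _ _ _ (phase (edge_index e)) sin); first exact: phc.
exact: continuous_sin.
Qed.

(** An extremum over [box] is also a value on [torus] by periodicity, and it stays extremal there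
    since [torus] lies in [box]. *)
Lemma band_edge_attained side j : (1 <= j <= nu G)%N ->
  side_extremum side (band_fun G Q j @` torus) (band_edge side G Q j).
Proof.
move=> /andP[j0 jnu]; apply: band_edge_extremum.
have jnu' : (j.-1 < nu G)%N by rewrite prednK.
have [x [[k kb <-] xmin]] := re_eigenvalue_extremum fiber_mx_continuous side jnu'.
exists (band_fun G Q j k); split; first exact: band_fun_torus.
move=> _ [k' k't <-]; apply: xmin; exists k'; last by [].
move=> s; by have /andP[/ltW -> ->] := k't s.
Qed.

End BandFunctions.

(** * The perturbed graph and the limit graph *)

(** Rows and columns undergo the same permutation, so the two signs cancel. *)
Lemma char_poly_reindex (C : comNzRingType) m n (A : 'M[C]_m) (B : 'M[C]_n)
    (h : 'I_m -> 'I_n) :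
  bijective h -> (forall i j, A i j = B (h i) (h j)) -> char_poly A = char_poly B.
Proof.
move=> hb AB; have mn : m = n by have := bij_eq_card hb; rewrite !card_ord.
move: n mn B h hb AB => _ <- B h hb AB.
pose s := perm (bij_inj hb).
have -> : A = row_perm s (col_perm s B).
  by apply/matrixP => i j; rewrite !mxE AB !permE.
have -> : char_poly (row_perm s (col_perm s B)) =
    \det (row_perm s (col_perm s (char_poly_mx B))).
  congr determinant; apply/matrixP => i j.
  by rewrite !mxE (inj_eq perm_inj).
by rewrite row_permE col_permE !det_mulmx !det_perm odd_permV mulrCA -signr_addb addbb mulr1.
Qed.

Lemma phase_row_mx (R : realType) d1 d2 (n1 : 'rV[int]_d1) (n2 : 'rV[int]_d2)
    (k1 : 'rV[R]_d1) (k2 : 'rV[R]_d2) :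
  phase (row_mx n1 n2) (row_mx k1 k2) = phase n1 k1 + phase n2 k2.
Proof.
rewrite /phase big_split_ord /=; congr (_ + _); apply: eq_bigr => s _.
  by rewrite !row_mxEl.
by rewrite !row_mxEr.
Qed.

Lemma phase0 (R : realType) d (k : 'rV[R]_d) : phase 0 k = 0.
Proof. by rewrite /phase big1 // => s _; rewrite mxE mul0r. Qed.

Lemma phaseN (R : realType) d n (k : 'rV[R]_d) : phase (- n) k = - phase n k.
Proof. by rewrite /phase -sumrN; apply: eq_bigr => s _; rewrite mxE mulrNz mulNr. Qed.

Lemma cell_part_shift (R : realType) d (G : lattice_graph R d) v n :
  basis G \in unitmx -> cell_part G (v + latvec (basis G) n) = cell_part G v.
Proof.
by move=> Au; rewrite /cell_part cell_indexD // latvecD opprD addrACA subrr addr0.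
Qed.

Lemma embed_inj (R : realType) d : injective (@embed R d).
Proof. by move=> v w /eq_row_mx[]. Qed.

(** * Fiber operators of the perturbed graph and of the limit graph *)

Section FiberComparison.
Context {R : realType} {d : nat}.
Variables (G : lattice_graph R d) (v1 v2 : 'rV[R]_d) (Q : 'rV[R]_d -> R).
Variables (t : 'rV[int]_d) (b : 'rV[R]_(d + 1)).
Hypotheses (hG : is_periodic_graph G) (hv1 : fund_vert G v1) (hv2 : fund_vert G v2).
Hypothesis bu : limit_basis G b \in unitmx.
Let Gt := perturbed_graph G v1 v2 t.
Let Gl := limit_graph G v1 v2 b.
Let Ql := limit_potential G v1 v2 b Q.

(** The lattice coordinates of [b], and the index of the added edge in the limit graph. *)
Let up : 'rV[int]_(d + 1) := row_mx 0 1%:M.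

Let latvec_up : latvec (limit_basis G b) up = b.
Proof.
rewrite latvec_limit row_mxKl row_mxKr latvec0 /embed row_mx0 add0r.
by rewrite mxE eqxx scale1r.
Qed.

(* The edge of the limit graph with the same projection to the common fundamental
   graph, chosen so that edges starting in the cell go to edges starting in the cell. *)
Let edge_map (e : edge Gt) : edge Gl :=
  match e with
  | inl e => inl (e, 0)
  | inr (c, _) => inr (c, if c then - up else 0)
  end.

Let limit_fund_vert_embed v : fund_vert G v -> fund_vert Gl (embed v).
Proof. by move=> vf; rewrite (limit_fund_vert v1 v2 hG bu); exists v. Qed.

Let fund_shift_eq v w n :
  fund_vert G v -> fund_vert G w -> v + latvec (basis G) n = w -> n = 0 /\ v = w.
Proof.
move=> [_ vc] [_ wc] vw; have n0 : n = 0.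
  by apply: (cell_uniq (basis_unit hG) vc); rewrite vw.
by split=> //; rewrite -vw n0 latvec0 addr0.
Qed.

Let limit_shift_eq v w n : fund_vert G v -> fund_vert G w ->
  embed v + latvec (limit_basis G b) n = embed w -> n = 0 /\ v = w.
Proof.
move=> /limit_fund_vert_embed[_ vc] /limit_fund_vert_embed[_ wc] vw.
have n0 : n = 0 by apply: (cell_uniq bu vc); rewrite vw.
by split=> //; apply: embed_inj; rewrite -vw n0 latvec0 addr0.
Qed.

(** At most one translate of the added edge, and one of its reverse, starts at a given cell vertex:
    the parameters can only be 0 and [- t] in [Gt], 0 and [- up] in [Gl]. Copies of old edges
    starting there lie in layer 0. *)
Let edge_map_bij v : fund_vert G v ->
  set_bij [set e : edge Gt | esrc e = v] [set e : edge Gl | esrc e = embed v] edge_map.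
Proof.
move=> vf; split.
- case=> [e|[[] n]] /=.
  + by move=> ->; rewrite scale0r addr0.
  + rewrite /pert_stop -addrA -latvecD => /(fund_shift_eq hv2 vf)[_ <-].
    by rewrite /limit_stop latvecN latvec_up addrK.
  + rewrite /pert_start => /(fund_shift_eq hv1 vf)[_ <-].
    by rewrite /limit_start latvec0 addr0.
- move=> [e|[c n]] [e'|[c' n']]; rewrite !inE //=.
    by move=> _ _ [->].
  (* [edge_map] forgets the parameter, but the starting point determines it. *)
  move=> en en' [cc' _]; move: cc' en en' => <-; case: c => /=.
    rewrite /pert_stop -!addrA -!latvecD => /(fund_shift_eq hv2 vf)[/eqP n0 _].
    move=> /(fund_shift_eq hv2 vf)[/eqP n'0 _]; move: n0 n'0.
    by rewrite ![t + _]addrC !addr_eq0 => /eqP -> /eqP ->.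
  rewrite /pert_start => /(fund_shift_eq hv1 vf)[-> _].
  by move=> /(fund_shift_eq hv1 vf)[-> _].
- case=> [[e m]|[[] n]] /=.
  (* The last coordinate of the cell index of the source is the layer [m]; for [embed v] it is 0. *)
  + move=> ev; have := limit_cell_index v1 v2 hG bu (esrc e) m; rewrite ev.
    have := limit_cell_index v1 v2 hG bu v 0; rewrite scale0r addr0 => ->.
    move=> /eq_row_mx[_ /matrixP/(_ 0 0)]; rewrite !mxE eqxx !mulr1n => m0.
    move: ev; rewrite -m0 scale0r addr0 => /embed_inj ev.
    by exists (inl e).
  + rewrite /limit_stop -{1}latvec_up -addrA -latvecD.
    move=> /(limit_shift_eq hv2 vf)[/eqP]; rewrite addrC addr_eq0 => /eqP -> vE.
    by exists (inr (true, - t)) => //=; rewrite /pert_stop latvecN addrK.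
  + move=> /(limit_shift_eq hv1 vf)[-> vE].
    by exists (inr (false, 0)) => //=; rewrite /pert_start latvec0 addr0.
Qed.

(** Old edges have the same index padded by 0. The added edge has index [t] in [Gt] and [up] in
    [Gl], and both give the phase [<t, k>] at [(k, <t, k>)]. *)
Lemma fiber_op_limit (k : 'rV[R]_d) (f : 'rV[R]_(d + 1) -> R[i]) v :
  fund_vert G v ->
  fiber_op Gl Ql (row_mx k (phase t k)%:M) f (embed v) =
  fiber_op Gt Q k (f \o @embed R d) v.
Proof.
move=> vf; rewrite /fiber_op /Ql limit_potentialE //; congr (_ + _).
rewrite (reindex_fsbig _ _ _ _ (edge_map_bij vf)); apply: eq_fsbigr => e _.
have Au : basis Gt \in unitmx := basis_unit hG.
have Bu : basis Gl \in unitmx := bu.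
(* Targets enter only through their cell parts, so the choice of translate in [edge_map] is
   invisible. *)
have tE w n : cell_part Gt (w + latvec (basis G) n) = cell_part Gt w := cell_part_shift w n Au.
have lE w n : cell_part Gl (w + latvec (limit_basis G b) n) = cell_part Gl w :=
  cell_part_shift w n Bu.
have cE w : cell_part Gl (embed w) = embed (cell_part Gt w).
  by have := limit_cell_part v1 v2 hG bu w 0; rewrite scale0r addr0.
have upE : phase up (row_mx k (phase t k)%:M) = phase t k.
  by rewrite phase_row_mx phase0 add0r {1}/phase big_ord1 !mxE eqxx mul1r.
have newE n n' : edge_index (inr (true, n) : edge Gt) = - edge_index (inr (false, n') : edge Gt).
  rewrite (perturbed_new_index hG hv1 hv2) -(perturbed_new_index hG hv1 hv2 t n).
  by rewrite /edge_index opprB.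
have newlE n n' : edge_index (inr (true, n) : edge Gl) = - edge_index (inr (false, n') : edge Gl).
  rewrite (limit_new_index hG hv1 hv2 bu) -(limit_new_index hG hv1 hv2 bu n).
  by rewrite /edge_index opprB.
congr (_ - expi _ * f _).
- case: e => [e|[[] n]].
  + by rewrite limit_index // phase_row_mx phase0 addr0.
  + by rewrite (newlE _ 0) (newE _ 0) limit_new_index // perturbed_new_index // !phaseN upE.
  + by rewrite limit_new_index // perturbed_new_index // upE.
- case: e => [e|[[] n]] /=.
  + by rewrite scale0r addr0 cE.
  + by rewrite /limit_start /pert_start !lE !tE cE.
  + rewrite /limit_stop /pert_stop -{1}latvec_up.
    by rewrite !lE !tE cE.
Qed.

Lemma nu_limit : nu Gl = nu Gt.
Proof.
rewrite /nu (limit_fund_vert v1 v2 hG bu) fset_set_image; last exact: fund_vert_finite hG.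
by rewrite card_imfset //; exact: embed_inj.
Qed.

(** The enumerations of the two vertex sets need not correspond under [embed]; [h] matches them.
    Then the characteristic polynomials agree, and [eigenvalues] depends on nothing else. *)
Lemma band_fun_limit j (k : 'rV[R]_d) :
  band_fun Gl Ql j (row_mx k (phase t k)%:M) = band_fun Gt Q j k.
Proof.
have pert : is_periodic_graph Gt by case: hv1 hv2 => ? _ [? _]; exact: perturbed_periodic.
have lim : is_periodic_graph Gl by case: hv1 hv2 => ? _ [? _]; exact: limit_periodic.
have fl : finite_set (fund_vert Gl) := fund_vert_finite lim.
pose s : seq _ := fset_set (fund_vert Gl).
have embs (i : 'I_(nu Gt)) : embed (fund_nth Gt i) \in s.
  rewrite /s in_fset_set // inE; apply: limit_fund_vert_embed.
  exact: (fund_nth_vert pert (ltn_ord i)).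
have hlt (i : 'I_(nu Gt)) : (index (embed (fund_nth Gt i)) s < nu Gl)%N.
  by rewrite index_mem.
pose h i := Ordinal (hlt i).
have hE i : fund_nth Gl (h i) = embed (fund_nth Gt i).
  by apply: nth_index; exact: embs.
have hi : injective h.
  move=> i i' /(congr1 (fun i => fund_nth Gl (nat_of_ord i))); rewrite !hE.
  move=> /embed_inj ii'; apply/val_inj/eqP.
  by rewrite -(nth_uniq 0 (ltn_ord i) (ltn_ord i') (fset_uniq _)); apply/eqP.
have hb : bijective h by apply: inj_card_bij; [exact: hi|rewrite !card_ord nu_limit].
suff fE i l : fiber_mx Gt Q k i l = fiber_mx Gl Ql (row_mx k (phase t k)%:M) (h i) (h l).
  by rewrite /band_fun /eigenvalues (char_poly_reindex hb fE).
rewrite !mxE !hE fiber_op_limit; last exact: (fund_nth_vert pert (ltn_ord i)).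
have -> // : (fun w => (w == embed (fund_nth Gt l))%:R : R[i]) \o @embed R d =
  (fun w => (w == fund_nth Gt l)%:R).
by apply/funext => w /=; rewrite (inj_eq (@embed_inj _ _)).
Qed.

End FiberComparison.

Theorem theorem2p4 (R : realType) (d : nat) (G : lattice_graph R d)
    (hG : is_periodic_graph G) (v1 v2 : 'rV[R]_d)
    (hv1 : fund_vert G v1) (hv2 : fund_vert G v2)
    (Q : 'rV[R]_d -> R) (hQ : periodic_potential G Q)
    (t : 'rV[int]_d)
    (b : 'rV[R]_(d + 1)) (hb : limit_basis G b \in unitmx)
    (j : nat) (hj : (1 <= j <= nu G)%N) (side : band_side) :
  let Gt := perturbed_graph G v1 v2 t in
  let Glim := limit_graph G v1 v2 b in
  let Qlim := limit_potential G v1 v2 b Q in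
  let K := band_level side Glim Qlim j in
  (band_edge side Gt Q j = band_edge side Glim Qlim j <->
   exists2 ko : 'rV[R]_(d + 1), K ko &
     eq_mod_2pi (\sum_(s < d) (t 0 s)%:~R * lsubmx ko 0 s) (rsubmx ko 0 0)) /\
  (K 0 -> band_edge side Gt Q j = band_edge side Glim Qlim j).
Proof.
move=> Gt Gl Ql K.
have pert : is_periodic_graph Gt by case: hv1 hv2 => ? _ [? _]; exact: perturbed_periodic.
have lim : is_periodic_graph Gl by case: hv1 hv2 => ? _ [? _]; exact: limit_periodic.
have [[kt ktT ktE] ext] := band_edge_attained Q pert side (j := j) hj.
have jl : (1 <= j <= nu Gl)%N by rewrite (nu_limit v1 v2 t hG hb).
have [_ extl] := band_edge_attained Ql lim side jl.
(* [band_fun_limit] for any representative modulo [2 * pi] of a point of the subtorus. *)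
have mod_row (k : 'rV[R]_d) (k' : 'rV[R]_(d + 1)) :
    (forall s, eq_mod_2pi (lsubmx k' 0 s) (k 0 s)) ->
    eq_mod_2pi (rsubmx k' 0 0) (phase t k) ->
    band_fun Gl Ql j k' = band_fun Gt Q j k.
  move=> kl kr; rewrite -(band_fun_limit Q t hG hv1 hv2 hb); apply: band_fun_period => s.
  rewrite -[k']hsubmxK; case: (split_ordP s) => i ->; first by rewrite !row_mxEl.
  by rewrite !row_mxEr ord1 [X in eq_mod_2pi _ X]mxE eqxx mulr1n.
have suff_ko : (exists2 ko : 'rV[R]_(d + 1), K ko &
    eq_mod_2pi (\sum_(s < d) (t 0 s)%:~R * lsubmx ko 0 s) (rsubmx ko 0 0)) ->
    band_edge side Gt Q j = band_edge side Gl Ql j.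
  move=> [ko [_ koE] kot].
  have E : band_fun Gl Ql j ko = band_fun Gt Q j (lsubmx ko).
    by apply: mod_row => [s|]; [exact: eq_mod_2pi_refl|exact: eq_mod_2pi_sym].
  (* The limit edge is a value of the band of [Gt] at [lsubmx ko]; conversely every value of that
     band, in particular its edge, is a value of the limit band. *)
  apply: (@side_le_anti _ side).
    by apply: ext; rewrite -koE E; exact: band_fun_torus.
  by apply: extl; rewrite -ktE -(band_fun_limit Q t hG hv1 hv2 hb); exact: band_fun_torus.
split; last first.
  move=> K0; apply: suff_ko; exists 0; first exact: K0.
  exists 0; rewrite mul0r big1 ?sub0r ?mxE ?oppr0 // => s _.
  by rewrite !mxE mulr0.
split; last exact: suff_ko.
(* The witness is [(kt, <t, kt>)] reduced to the torus, where [kt] attains the edge of [Gt]. *)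
move=> E; have [ko koT koE] := torus_repr (row_mx kt (phase t kt)%:M : 'rV[R]_(d + 1)).
have kol s : eq_mod_2pi (lsubmx ko 0 s) (kt 0 s).
  by have := koE (lshift 1 s); rewrite row_mxEl mxE.
have kor : eq_mod_2pi (rsubmx ko 0 0) (phase t kt).
  by have := koE (rshift d 0); rewrite row_mxEr !mxE eqxx mulr1n.
exists ko.
  split; first exact: koT.
  by rewrite /= (mod_row kt) // ktE.
have [m1 h1] := eq_mod_2pi_phase t kol; have [m2 h2] := kor.
(* [m1] comes from reducing the first [d] coordinates, [m2] from reducing the last one. *)
by exists (m1 - m2); rewrite intrB mulrBl -h1 -h2 opprB addrA subrK.
Qed.
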